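(* Let $(\Omega,2^\Omega,\mu)$ be a finite probability space and let $(P_t)_{t\ge0}$ be a symmetric Markov semigroup on $L^2(\Omega,\mu)$ with generator $L$. Assume that there is a constant $C>0$ such that $\mathbb{E}f^2-(\mathbb{E}f)^2\le C\cdot\mathbb{E}[fLf]$ for every $f\colon\Omega\to\mathbb{R}$. Then for every $p\in(1,\infty)$ and every $f\colon\Omega\to\mathbb{R}$ with $\mathbb{E}f=0$, $$\mathbb{E}\left[|f|^{p-1}\,\mathrm{sign}(f)\,Lf\right]\ \ge\ \frac{2p-2}{(p^2-2p+2)C}\cdot\mathbb{E}|f|^p .$$
   Context: $\mathbb{E}$ denotes expectation with respect to $\mu$. A symmetric Markov semigroup is a (continuous in $t$) family of linear operators with $P_0=\mathrm{Id}$, $P_{s+t}=P_sP_t$, each $P_t$ positivity preserving, $P_t\mathbf{1}=\mathbf{1}$, and self-adjoint on $L^2(\Omega,\mu)$ (so $\mu$ is invariant). Its generator is $L=-\frac{\mathrm d}{\mathrm dt}P_t\big|_{t=0^+}$. The function $|f|^{p-1}\mathrm{sign}(f)$ is $0$ where $f=0$. *)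

(* Defs.v *)
From HB Require Import structures.
From mathcomp Require Import all_boot all_order all_algebra.
From mathcomp Require Import all_classical all_reals all_analysis.
Import Order.TTheory GRing.Theory Num.Theory.
Import numFieldNormedType.Exports.

Set Implicit Arguments.
Unset Strict Implicit.
Unset Printing Implicit Defensive.

Local Open Scope classical_set_scope.
Local Open Scope ring_scope.

Definition fin_prob (R : realType) (Omega : finType) (mu : Omega -> R) : Prop :=
  (forall x, 0 <= mu x) /\ \sum_x mu x = 1.

Definition Ex (R : realType) (Omega : finType) (mu f : Omega -> R) : R :=
  \sum_x mu x * f x.

(* Atoms of mass 0 are allowed, so an element of L^2(Omega, mu) is a function
   Omega -> R up to equality on the atoms of positive mass. *)
Definition mu_ae (R : realType) (Omega : finType) (mu : Omega -> R)
    (Q : Omega -> Prop) : Prop :=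
  forall x, mu x != 0 -> Q x.

(* Operators on L^2(Omega, mu) are given by their action on representatives,
   hence all the laws are required mu-almost everywhere.  Only the values
   [P t] with [0 <= t] are constrained or used. *)
Record symmetric_markov_semigroup (R : realType) (Omega : finType)
    (mu : Omega -> R) (P : R -> (Omega -> R) -> (Omega -> R)) : Prop := {
  sms_welldef : forall (t : R) (f g : Omega -> R), 0 <= t ->
    mu_ae mu (fun x => f x = g x) -> mu_ae mu (fun x => P t f x = P t g x);
  sms_linear : forall (t a : R) (f g : Omega -> R), 0 <= t ->
    mu_ae mu (fun x => P t (fun y => a * f y + g y) x = a * P t f x + P t g x);
  sms_id : forall f : Omega -> R, mu_ae mu (fun x => P 0 f x = f x);
  sms_add : forall (s t : R) (f : Omega -> R), 0 <= s -> 0 <= t ->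
    mu_ae mu (fun x => P (s + t) f x = P s (P t f) x);
  (* As Omega is finite, continuity in L^2(Omega, mu) is continuity at each
     atom of positive mass. *)
  sms_continuous : forall f : Omega -> R,
    mu_ae mu (fun x => {within `[0, +oo[, continuous (fun t : R => P t f x)});
  sms_positive : forall (t : R) (f : Omega -> R), 0 <= t ->
    mu_ae mu (fun x => 0 <= f x) -> mu_ae mu (fun x => 0 <= P t f x);
  sms_unit : forall t : R, 0 <= t ->
    mu_ae mu (fun x => P t (fun=> 1) x = 1);
  sms_selfadjoint : forall (t : R) (f g : Omega -> R), 0 <= t ->
    Ex mu (fun x => P t f x * g x) = Ex mu (fun x => f x * P t g x)
}.

(* Sign convention: L = - d/dt P_t at t = 0+, a nonnegative operator. *)
Definition is_generator (R : realType) (Omega : finType) (mu : Omega -> R)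
    (P : R -> (Omega -> R) -> (Omega -> R))
    (L : (Omega -> R) -> (Omega -> R)) : Prop :=
  forall f : Omega -> R, mu_ae mu (fun x =>
    - ((P t f x - P 0 f x) / t) @[t --> 0^'+] --> L f x).

(* Main.v *)
(* Write [q = p - 1] and let [phi], [psi] be the signed powers with exponents
   [q] and [(q + 1) / 2 = p / 2].  Since [E f = 0], [E |f|^p] is the covariance
   of [f] and [phi f].  A pointwise comparison of [(a - b) (phi a - phi b)] with
   [(psi a - psi b)^2] bounds this covariance by the variance of [psi f], to which
   the Poincare inequality applies; the opposite (Stroock-Varopoulos) comparison
   bounds the Dirichlet form of [psi f] by [E (phi f) (L f)].  The constants
   [2 (q^2 + 1) / (q + 1)^2] and [(q + 1)^2 / (4 q)] multiply to
   [(q^2 + 1) / (2 q)].  Both comparisons come from the monotonicity of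
   [sinh x / x], after the substitution [a = m e^u], [b = m e^-u]. *)
Require Import Defs.
From HB Require Import structures.
From mathcomp Require Import all_boot all_order all_algebra.
From mathcomp Require Import all_classical all_reals all_analysis.
From mathcomp Require Import ring lra.
Import Order.TTheory GRing.Theory Num.Theory.
Import numFieldNormedType.Exports.
Set Implicit Arguments.
Unset Strict Implicit.
Unset Printing Implicit Defensive.

Local Open Scope ring_scope.

(** * Monotonicity of hyperbolic functions *)

Lemma expRDN_le (R : realType) (a b : R) : `|a| <= b ->
  expR a + expR (- a) <= expR b + expR (- b).
Proof.
wlog a0 : a / 0 <= a.
  move=> H ab; case: (leP 0 a) => [/H|/ltW a0]; first exact.
  by have := H (- a); rewrite oppr_ge0 normrN opprK addrC; apply.
rewrite ger0_norm// => ab; rewrite !expRN -subr_ge0.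
have ea : 1 <= expR a by rewrite -expR0 ler_expR.
have eab : expR a <= expR b by rewrite ler_expR.
have := @expR_gt0 R a; have := @expR_gt0 R b => eb0 ea0.
have -> : expR b + (expR b)^-1 - (expR a + (expR a)^-1) =
    (expR b - expR a) * (expR b * expR a - 1) * ((expR a)^-1 * (expR b)^-1).
  by field; rewrite !gt_eqF.
rewrite !mulr_ge0 ?invr_ge0 ?expR_ge0 ?subr_ge0//.
by rewrite (le_trans ea)// ler_peMl// ?(le_trans ea)// ltW.
Qed.

(** The mean value theorem applied to a sinh(b v) - b sinh(a v), up to a factor 2: it vanishes at 0
    and its derivative a b (cosh(b v) - cosh(a v)) is nonnegative for v >= 0. *)
Lemma expRBN_ratio_le (R : realType) (a b u : R) : 0 <= a -> a <= b -> 0 <= u ->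
  b * (expR (a * u) - expR (- (a * u))) <= a * (expR (b * u) - expR (- (b * u))).
Proof.
move=> a0 ab u0; rewrite -subr_ge0.
have b0 : 0 <= b by exact: le_trans ab.
pose G (v : R) := a * (expR (b * v) - expR (- (b * v)))
  - b * (expR (a * v) - expR (- (a * v))).
pose G' (v : R) := a * b * (expR (b * v) + expR (- (b * v))
  - (expR (a * v) + expR (- (a * v)))).
have dG (v : R) : is_derive v 1 G (G' v).
  apply: is_derive_eq; rewrite /G' /GRing.scale /=; ring.
have -> : a * (expR (b * u) - expR (- (b * u))) -
   b * (expR (a * u) - expR (- (a * u))) = G u by [].
have <- : G 0 = 0 by rewrite /G !mulr0 oppr0 !subrr !mulr0 subrr.
have [->//|un0] := eqVneq u 0.
have {un0}u0' : 0 < u by rewrite lt_def un0.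
have [|c] := @MVT R G G' 0 u u0'.
  apply: derivable_within_continuous => x _.
  by apply: ex_derive.
rewrite in_itv/= => /andP[c0 _] GE; rewrite -subr_ge0 GE.
rewrite !mulr_ge0 ?subr0 // subr_ge0 expRDN_le// ger0_norm ?mulr_ge0 ?(ltW c0)//.
by rewrite ler_wpM2r// ltW.
Qed.

(** After squaring, both sides are even in [a] and in [u], which reduces to nonnegative arguments. A
    negative [a] occurs below when [q < 1]. *)
Lemma expRBN_sqr_ratio_le (R : realType) (a b u : R) : `|a| <= b ->
  b ^+ 2 * (expR (a * u) - expR (- (a * u))) ^+ 2 <=
  a ^+ 2 * (expR (b * u) - expR (- (b * u))) ^+ 2.
Proof.
wlog a0 : a / 0 <= a.
  move=> H ab; case: (leP 0 a) => [/H|/ltW a0]; first exact.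
  have := H (- a); rewrite oppr_ge0 normrN mulNr opprK sqrrN => /(_ a0 ab).
  by rewrite -[X in b ^+ 2 * X <= _]sqrrN opprB.
wlog u0 : u / 0 <= u.
  move=> H ab; case: (leP 0 u) => [/H|/ltW u0]; first exact.
  have := H (- u); rewrite oppr_ge0 !mulrN !opprK => /(_ u0 ab).
  by rewrite -[X in b ^+ 2 * X <= _]sqrrN -[X in _ <= a ^+ 2 * X]sqrrN !opprB.
rewrite ger0_norm// => ab; have b0 : 0 <= b by exact: le_trans ab.
have sh_ge0 c : 0 <= c -> 0 <= expR (c * u) - expR (- (c * u)).
  move=> c0; have cu0 : 0 <= c * u by rewrite mulr_ge0.
  by rewrite subr_ge0 ler_expR (le_trans _ cu0)// oppr_le0.
by rewrite -!exprMn ler_sqr ?nnegrE ?mulr_ge0 ?sh_ge0// expRBN_ratio_le.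
Qed.

(** * Pointwise comparison of signed powers *)

Lemma powR_cross_diff_le (R : realType) (q a b : R) : 0 < q -> 0 <= a -> 0 <= b ->
  (q + 1) ^+ 2 * (a `^ 2^-1 * b `^ (q / 2) - a `^ (q / 2) * b `^ 2^-1) ^+ 2 <=
  (q - 1) ^+ 2 * (a `^ 2^-1 * a `^ (q / 2) - b `^ 2^-1 * b `^ (q / 2)) ^+ 2.
Proof.
move=> q0.
have q20 : q / 2 != 0 by rewrite gt_eqF// divr_gt0.
have h0 : (2^-1 : R) != 0 by rewrite invr_eq0 pnatr_eq0.
have [->|an0] := eqVneq a 0.
  by move=> *; rewrite !powR0// !mul0r subrr expr0n mulr0 mulr_ge0 ?sqr_ge0.
have [->|bn0] := eqVneq b 0.
  by move=> *; rewrite !powR0// !mulr0 subrr expr0n mulr0 mulr_ge0 ?sqr_ge0.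
move=> _ _; rewrite /powR (negbTE an0) (negbTE bn0) -!expRD.
set x := ln a; set y := ln b.
(* Since [x = m + d] and [y = m - d], each product of powers is [E] times an exponential in [d],
   with rates +-(q - 1)/2 on the left and +-(q + 1)/2 on the right. *)
pose m := (x + y) / 2; pose d := (x - y) / 2.
have al : `|(q - 1) / 2| <= (q + 1) / 2 by rewrite ler_norml; lra.
have := @expRBN_sqr_ratio_le R _ _ d al.
set E := expR ((q + 1) / 2 * m).
have e1 : expR (2^-1 * x + q / 2 * y) = E * expR (- ((q - 1) / 2 * d)).
  by rewrite /E -expRD /m /d; congr expR; field.
have e2 : expR (q / 2 * x + 2^-1 * y) = E * expR ((q - 1) / 2 * d).
  by rewrite /E -expRD /m /d; congr expR; field.
have e3 : expR (2^-1 * x + q / 2 * x) = E * expR ((q + 1) / 2 * d).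
  by rewrite /E -expRD /m /d; congr expR; field.
have e4 : expR (2^-1 * y + q / 2 * y) = E * expR (- ((q + 1) / 2 * d)).
  by rewrite /E -expRD /m /d; congr expR; field.
rewrite e1 e2 e3 e4 => H.
have E4 : 0 <= 4 * E ^+ 2 by rewrite mulr_ge0 ?sqr_ge0.
have := ler_wpM2l E4 H; congr (_ <= _); by field.
Qed.

(** The factor [Num.sg a] forces the value 0 at 0 for every exponent, including [r = 0], where |0|^r
    is 1. *)
Definition spow (R : realType) (r a : R) : R := `|a| `^ r * Num.sg a.

Lemma spow_ge0E (R : realType) (r a : R) : r != 0 -> 0 <= a -> spow r a = a `^ r.
Proof.
move=> r0; rewrite le_eqVlt => /orP[/eqP <-|a0].
  by rewrite /spow sgr0 mulr0 powR0.
by rewrite /spow gtr0_sg// gtr0_norm// mulr1.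
Qed.

Lemma spowN (R : realType) (r a : R) : spow r (- a) = - spow r a.
Proof. by rewrite /spow normrN sgrN mulrN. Qed.

Lemma mulr_spow (R : realType) (r a : R) : r != - 1 -> a * spow r a = `|a| `^ (r + 1).
Proof.
move=> r0; have r10 : r + 1 != 0 by rewrite addr_eq0.
have [->|an0] := eqVneq a 0; first by rewrite normr0 powR0// mul0r.
by rewrite powRD ?normr_eq0 ?an0 ?implybT// powRr1// /spow mulrCA (mulrC a) -normrEsg.
Qed.

(* [(a - b) (a^q - b^q) = (X - Y)^2 - D^2] when [a], [b] have the same sign and
   [(X - Y)^2 + D^2] otherwise, where [X], [Y] are the signed powers with
   exponent [(q + 1) / 2] and [D] is the difference bounded in [powR_cross_diff_le]. *)
Lemma spow_diff_bounds (R : realType) (q a b : R) : 0 < q ->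
  (q + 1) ^+ 2 * ((a - b) * (spow q a - spow q b)) <=
    2 * (q ^+ 2 + 1) * (spow ((q + 1) / 2) a - spow ((q + 1) / 2) b) ^+ 2
  /\ 4 * q * (spow ((q + 1) / 2) a - spow ((q + 1) / 2) b) ^+ 2 <=
    (q + 1) ^+ 2 * ((a - b) * (spow q a - spow q b)).
Proof.
move=> q0.
have q1 : (q + 1) / 2 != 0 by rewrite gt_eqF// divr_gt0// addr_gt0.
(* Every power is a monomial in c^(1/2) and c^(q/2), so both bounds become polynomial
   inequalities. *)
have split_powR (c : R) : 0 <= c -> [/\ c = (c `^ 2^-1) ^+ 2,
    c `^ q = (c `^ (q / 2)) ^+ 2 & c `^ ((q + 1) / 2) = c `^ 2^-1 * c `^ (q / 2)].
  move=> c0; split; rewrite ?expr2 -powRD; try by apply/implyP => /eqP; lra.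
  - by rewrite (_ : 2^-1 + 2^-1 = 1) ?powRr1//; field.
  - by congr (_ `^ _); field.
  - by congr (_ `^ _); field.
have same (c d : R) : 0 <= c -> 0 <= d ->
    (q + 1) ^+ 2 * ((c - d) * (c `^ q - d `^ q)) <=
    2 * (q ^+ 2 + 1) * (c `^ ((q + 1) / 2) - d `^ ((q + 1) / 2)) ^+ 2 /\
    4 * q * (c `^ ((q + 1) / 2) - d `^ ((q + 1) / 2)) ^+ 2 <=
    (q + 1) ^+ 2 * ((c - d) * (c `^ q - d `^ q)).
  move=> c0 d0; have := powR_cross_diff_le q0 c0 d0.
  have [+ -> ->] := split_powR c c0; have [+ -> ->] := split_powR d d0.
  set A := c `^ 2^-1; set A' := c `^ _; set B := d `^ 2^-1; set B' := d `^ _.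
  move=> -> ->.
  (* As 2(q^2 + 1) = (q + 1)^2 + (q - 1)^2, the first bound follows from these two squares. As 4q =
     (q + 1)^2 - (q - 1)^2, the second is [powR_cross_diff_le]. *)
  have := sqr_ge0 ((q - 1) * (A * A' - B * B')).
  have := sqr_ge0 ((q + 1) * (A * B' - A' * B)).
  by split; nra.
have opposite (c d : R) : 0 <= c -> 0 <= d ->
    (q + 1) ^+ 2 * ((c + d) * (c `^ q + d `^ q)) <=
    2 * (q ^+ 2 + 1) * (c `^ ((q + 1) / 2) + d `^ ((q + 1) / 2)) ^+ 2 /\
    4 * q * (c `^ ((q + 1) / 2) + d `^ ((q + 1) / 2)) ^+ 2 <=
    (q + 1) ^+ 2 * ((c + d) * (c `^ q + d `^ q)).
  move=> c0 d0; have := powR_cross_diff_le q0 c0 d0.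
  have [+ -> ->] := split_powR c c0; have [+ -> ->] := split_powR d d0.
  set A := c `^ 2^-1; set A' := c `^ _; set B := d `^ 2^-1; set B' := d `^ _.
  move=> -> ->.
  have := sqr_ge0 ((q - 1) * (A * A' + B * B')).
  have := sqr_ge0 ((q + 1) * (A * B' - A' * B)).
  (* Here the roles are exchanged: the first bound needs [powR_cross_diff_le], and four times this
     term turns its (AA' - BB')^2 into (AA' + BB')^2. *)
  have : 0 <= (q - 1) ^+ 2 * ((A * A') * (B * B')).
    by rewrite mulr_ge0 ?sqr_ge0// !mulr_ge0 ?powR_ge0.
  by split; nra.
have sE (r c : R) : r != 0 -> c <= 0 -> spow r c = - (- c) `^ r.
  by move=> r0 c0; rewrite -[in LHS](opprK c) spowN spow_ge0E// oppr_ge0.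
have qn0 : q != 0 by rewrite gt_eqF.
have [a0|/ltW a0] := leP 0 a; have [b0|/ltW b0] := leP 0 b.
- by rewrite !spow_ge0E//; exact: same.
- have nb0 : 0 <= - b by rewrite oppr_ge0.
  by rewrite !(spow_ge0E _ a0)// !(sE _ b)// !opprK; exact: opposite.
- have na0 : 0 <= - a by rewrite oppr_ge0.
  have := opposite _ _ b0 na0; rewrite !(spow_ge0E _ b0)// !(sE _ a)//.
  set x := _ `^ _; set y := _ `^ _; set z := _ `^ _; set w := _ `^ _ => -[h1 h2].
  by split; lra.
- have na0 : 0 <= - a by rewrite oppr_ge0.
  have nb0 : 0 <= - b by rewrite oppr_ge0.
  have := same _ _ nb0 na0; rewrite !sE//.
  set x := _ `^ _; set y := _ `^ _; set z := _ `^ _; set w := _ `^ _ => -[h1 h2].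
  by split; lra.
Qed.

(** * Quadratic forms of symmetric kernels *)

(** When the product of differences is expanded, the marginal condition evaluates both diagonal
    terms and symmetry identifies the cross terms. *)
Lemma sum_sym_kernel_diff (R : realType) (T : finType) (m : T -> R)
    (w : T -> T -> R) (g h : T -> R) :
  (forall x y, w x y = w y x) -> (forall x, \sum_y w x y = m x) ->
  2 * (\sum_x m x * (g x * h x) - \sum_x \sum_y w x y * (g x * h y)) =
  \sum_x \sum_y w x y * ((g x - g y) * (h x - h y)).
Proof.
move=> wC wm.
have d1 : \sum_x \sum_y w x y * (g x * h x) = \sum_x m x * (g x * h x).
  by apply: eq_bigr => x _; rewrite -mulr_suml wm.
have d2 : \sum_x \sum_y w x y * (g y * h y) = \sum_x m x * (g x * h x).
  rewrite exchange_big -d1; apply: eq_bigr => x _; apply: eq_bigr => y _.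
  by rewrite wC.
have c2 : \sum_x \sum_y w x y * (g y * h x) = \sum_x \sum_y w x y * (g x * h y).
  by rewrite exchange_big; apply: eq_bigr => x _; apply: eq_bigr => y _; rewrite wC.
rewrite mulrBr [2 * _]mulr_natl [2 * _ in X in _ - X]mulr_natl !mulr2n.
rewrite -[in X in X + _ - _]d1 -[in X in _ + X - _]d2 -[in X in _ - (_ + X)]c2.
rewrite opprD -!sumrN -!big_split; apply: eq_bigr => x _ /=.
rewrite -!sumrN -!big_split; apply: eq_bigr => y _ /=.
ring.
Qed.

(** Used twice: with the transition kernel for Dirichlet forms, and with the product measure for
    covariances. *)
Lemma sum_sym_kernel_diff_le (R : realType) (T : finType) (m : T -> R)
    (w : T -> T -> R) (c d : R) (g h g' h' : T -> R) :
  (forall x y, 0 <= w x y) ->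
  (forall x y, w x y = w y x) -> (forall x, \sum_y w x y = m x) ->
  (forall x y, c * ((g x - g y) * (h x - h y)) <=
               d * ((g' x - g' y) * (h' x - h' y))) ->
  c * (\sum_x m x * (g x * h x) - \sum_x \sum_y w x y * (g x * h y)) <=
  d * (\sum_x m x * (g' x * h' x) - \sum_x \sum_y w x y * (g' x * h' y)).
Proof.
move=> w0 wC wm H; rewrite -(@ler_pM2l _ 2)// !(mulrCA 2).
rewrite !sum_sym_kernel_diff// !mulr_sumr; apply: ler_sum => x _.
rewrite !mulr_sumr; apply: ler_sum => y _.
by rewrite mulrCA [leRHS]mulrCA ler_wpM2l.
Qed.

(** * Transition kernel of the semigroup *)

Lemma sms_sum (R : realType) (T : finType) (mu : T -> R)
    (P : R -> (T -> R) -> (T -> R)) (t : R) (I : Type) (r : seq I)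
    (c : I -> R) (F : I -> T -> R) (x : T) :
  symmetric_markov_semigroup mu P -> 0 <= t -> mu x != 0 ->
  P t (fun y => \sum_(i <- r) c i * F i y) x = \sum_(i <- r) c i * P t (F i) x.
Proof.
move=> hP t0 x0; elim: r => [|i r IH].
  have -> : (fun y => \sum_(i <- [::]) c i * F i y) = (fun=> 0).
    by apply/funext => y; rewrite big_nil.
  (* On zero functions linearity reads v = v + v, so v = 0. *)
  have := sms_linear hP 1 (fun=> 0) (fun=> 0) t0 x0.
  by rewrite big_nil !mul1r addr0; lra.
rewrite big_cons -IH -(sms_linear hP _ _ _ t0 x0); congr (P t _ x).
by apply/funext => y; rewrite big_cons.
Qed.

(** The joint law of the stationary chain at times 0 and [t]. The weight [mu x] makes it symmetric
    and removes null atoms, where [P t] is unconstrained. *)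
Definition transition (R : realType) (T : finType) (mu : T -> R)
    (P : R -> (T -> R) -> (T -> R)) (t : R) (x y : T) : R :=
  mu x * P t (fun z => (z == y)%:R) x.

Section transition.
Variables (R : realType) (T : finType) (mu : T -> R).
Variables (P : R -> (T -> R) -> (T -> R)) (t : R).
Hypotheses (hmu : fin_prob mu) (hP : symmetric_markov_semigroup mu P).
Hypothesis t0 : 0 <= t.

Lemma transition_ge0 x y : 0 <= transition mu P t x y.
Proof.
rewrite /transition; have [->|x0] := eqVneq (mu x) 0; first by rewrite mul0r.
rewrite mulr_ge0//; first exact: hmu.1.
by apply: (sms_positive hP t0) => // z _; rewrite ler0n.
Qed.

(** Self-adjointness tested on two point indicators. *)
Lemma transitionC x y : transition mu P t x y = transition mu P t y x.
Proof.
have ExE z (g : T -> R) : \sum_u mu u * (g u * (u == z)%:R) = mu z * g z.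
  rewrite (bigD1 z)//= eqxx mulr1 big1 ?addr0// => u /negbTE ->.
  by rewrite !mulr0.
have := sms_selfadjoint hP (fun z => (z == y)%:R) (fun z => (z == x)%:R) t0.
rewrite /Ex ExE /transition => ->; rewrite -(ExE y (P t _)).
by apply: eq_bigr => u _; congr (_ * _); rewrite mulrC.
Qed.

Lemma Ex_mulP_transition (g h : T -> R) :
  Ex mu (fun x => g x * P t h x) = \sum_x \sum_y transition mu P t x y * (g x * h y).
Proof.
apply: eq_bigr => x _; rewrite /transition.
have [->|x0] := eqVneq (mu x) 0; first by rewrite mul0r big1// => y _; rewrite !mul0r.
have {1}-> : h = fun z => \sum_y h y * (z == y)%:R.
  apply/funext => z; rewrite (bigD1 z)//= eqxx mulr1 big1 ?addr0// => y.
  by rewrite eq_sym => /negbTE ->; rewrite mulr0.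
rewrite (sms_sum _ _ _ hP t0 x0) !mulr_sumr; apply: eq_bigr => y _; ring.
Qed.

Lemma transition_sum x : \sum_y transition mu P t x y = mu x.
Proof.
rewrite /transition -mulr_sumr.
have [->|x0] := eqVneq (mu x) 0; first by rewrite mul0r.
rewrite -[RHS]mulr1 -[X in _ = _ * X](sms_unit hP t0 x0); congr (_ * _).
have -> : (fun=> 1) = fun z : T => \sum_y 1 * (z == y)%:R :> R.
  apply/funext => z; rewrite (bigD1 z)//= eqxx mulr1 big1 ?addr0// => y.
  by rewrite eq_sym => /negbTE ->; rewrite mulr0.
by rewrite (sms_sum _ _ _ hP t0 x0); apply: eq_bigr => y _; rewrite mul1r.
Qed.

End transition.

(** * Comparison of Dirichlet forms and covariances *)

(** For each [t > 0] the difference quotient is a kernel form divided by [t], so the pointwise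
    comparison applies; then [t] tends to 0. *)
Lemma dirichlet_form_le (R : realType) (T : finType) (mu : T -> R)
    (P : R -> (T -> R) -> (T -> R)) (L : (T -> R) -> (T -> R)) (c d : R)
    (g h g' h' : T -> R) :
  fin_prob mu -> symmetric_markov_semigroup mu P -> is_generator mu P L ->
  (forall x y, c * ((g x - g y) * (h x - h y)) <=
               d * ((g' x - g' y) * (h' x - h' y))) ->
  c * Ex mu (fun x => g x * L h x) <= d * Ex mu (fun x => g' x * L h' x).
Proof.
move=> hmu hP hL H.
pose D (u v : T -> R) (t : R) := Ex mu (fun x => u x * - ((P t v x - P 0 v x) / t)).
have cvgD' (u v : T -> R) :
    (D u v t @[t --> 0^'+] --> Ex mu (fun x => u x * L v x))%classic.
  apply: cvg_big => [|x _]; first exact: add_continuous.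
  have [->|x0] := eqVneq (mu x) 0.
    by rewrite mul0r; under eq_fun do rewrite mul0r; exact: cvg_cst.
  apply: cvgM; first exact: cvg_cst.
  by apply: cvgM; [exact: cvg_cst | exact: hL].
apply: (ler_cvg_to (cvgM (cvg_cst c) (cvgD' g h)) (cvgM (cvg_cst d) (cvgD' g' h'))).
near=> t.
have t0 : 0 < t by near: t; exact: nbhs_right_gt.
have DE (u v : T -> R) : D u v t = t^-1 * (\sum_x mu x * (u x * v x) -
    \sum_x \sum_y transition mu P t x y * (u x * v y)).
  rewrite -Ex_mulP_transition ?(ltW t0)// /D /Ex -sumrB mulr_sumr.
  apply: eq_bigr => x _; have [->|x0] := eqVneq (mu x) 0.
    by rewrite !mul0r subrr mulr0.
  by rewrite (sms_id hP _ x0); ring.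
rewrite -[leLHS]/(c * D g h t) -[leRHS]/(d * D g' h' t) !DE !(mulrCA _ t^-1) ler_pM2l ?invr_gt0//.
apply: sum_sym_kernel_diff_le => //.
- by move=> x y; apply: transition_ge0 => //; exact: ltW.
- by move=> x y; apply: transitionC => //; exact: ltW.
- by move=> x; apply: transition_sum => //; exact: ltW.
Unshelve. all: by end_near. Qed.

(** The kernel [mu x * mu y] has marginal [mu] because the total mass is 1. *)
Lemma covariance_le (R : realType) (T : finType) (mu : T -> R) (c d : R)
    (g h g' h' : T -> R) : fin_prob mu ->
  (forall x y, c * ((g x - g y) * (h x - h y)) <=
               d * ((g' x - g' y) * (h' x - h' y))) ->
  c * (Ex mu (fun x => g x * h x) - Ex mu g * Ex mu h) <=
  d * (Ex mu (fun x => g' x * h' x) - Ex mu g' * Ex mu h').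
Proof.
move=> [mu0 mu1] H.
have ExM (u v : T -> R) :
    Ex mu u * Ex mu v = \sum_x \sum_y (mu x * mu y) * (u x * v y).
  rewrite /Ex mulr_suml; apply: eq_bigr => x _; rewrite mulr_sumr.
  by apply: eq_bigr => y _; rewrite mulrACA.
rewrite !ExM; apply: sum_sym_kernel_diff_le => //.
- by move=> x y; rewrite mulr_ge0.
- by move=> x y; rewrite mulrC.
- by move=> x; rewrite -mulr_sumr mu1 mulr1.
Qed.

Theorem theorem1p18 (R : realType) (Omega : finType) (mu : Omega -> R)
    (P : R -> (Omega -> R) -> (Omega -> R))
    (L : (Omega -> R) -> (Omega -> R)) (C : R)
    (hmu : fin_prob mu)
    (hP : symmetric_markov_semigroup mu P)
    (hL : is_generator mu P L)
    (hC : 0 < C)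
    (hpoincare : forall f : Omega -> R,
      Ex mu (fun x => f x ^+ 2) - Ex mu f ^+ 2 <= C * Ex mu (fun x => f x * L f x))
    (p : R) (hp : 1 < p) (f : Omega -> R) (hf : Ex mu f = 0) :
  Ex mu (fun x => `|f x| `^ (p - 1) * Num.sg (f x) * L f x) >=
    (2 * p - 2) / ((p ^+ 2 - 2 * p + 2) * C) * Ex mu (fun x => `|f x| `^ p).
Proof.
pose q := p - 1; have q0 : 0 < q by rewrite subr_gt0.
pose phi x := spow q (f x); pose psi x := spow ((q + 1) / 2) (f x).
have -> : Ex mu (fun x => `|f x| `^ p) = Ex mu (fun x => f x * phi x).
  apply: eq_bigr => x _; rewrite mulr_spow ?subrK//.
  by apply/eqP => qN1; move: q0; rewrite qN1; lra.
rewrite -/q -[X in _ <= X]/(Ex mu (fun x => phi x * L f x)).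
have Hcov : (q + 1) ^+ 2 * Ex mu (fun x => f x * phi x) <=
    2 * (q ^+ 2 + 1) * (Ex mu (fun x => psi x ^+ 2) - Ex mu psi ^+ 2).
  have := @covariance_le R Omega mu _ (2 * (q ^+ 2 + 1)) f phi psi psi hmu
    (fun x y => (spow_diff_bounds (f x) (f y) q0).1).
  by rewrite hf mul0r subr0.
have Hdir : 4 * q * Ex mu (fun x => psi x * L psi x) <=
    (q + 1) ^+ 2 * Ex mu (fun x => phi x * L f x).
  apply: (dirichlet_form_le hmu hP hL) => x y.
  (* [L] acts on the second function of the form, so [f] has to stand there and [phi] first. *)
  by rewrite [in leRHS](mulrC (phi x - _)); exact: (spow_diff_bounds (f x) (f y) q0).2.
have Hpoi := hpoincare psi.
have -> : p ^+ 2 - 2 * p + 2 = q ^+ 2 + 1 by rewrite /q; ring.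
have -> : 2 * p - 2 = 2 * q by rewrite /q; ring.
have K0 : 0 < q ^+ 2 + 1 by rewrite ltr_wpDl ?sqr_ge0.
rewrite mulrAC ler_pdivrMr ?mulr_gt0//.
rewrite -(@ler_pM2l _ (2 * (q + 1) ^+ 2)); last by rewrite mulr_gt0// exprn_gt0// addr_gt0.
move: Hcov Hdir Hpoi; set X := Ex _ _; set Y := _ - _; set Z := Ex _ _; set W := Ex _ _.
move=> h1 h2 h3.
(* The multipliers are chosen so that, on adding the three inequalities, the variance and the
   Dirichlet form of [psi] cancel. *)
have k1 := ler_wpM2l (ltW (mulr_gt0 (ltr0n R 4) q0)) h1.
have k2 : 0 <= 2 * (q ^+ 2 + 1) * C by rewrite !mulr_ge0// ltW.
have := ler_wpM2l k2 h2.
have k3 : 0 <= 2 * (q ^+ 2 + 1) * (4 * q) by rewrite !mulr_ge0// ltW.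
have := ler_wpM2l k3 h3.
lra.
Qed.
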